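(* For any finite simple graph $G$ with $m$ edges which is not a linear forest, $c_2(G)\leq m-1$.
   Context: All graphs are finite and simple. A subgraph complementation system for a graph $G=(V,E)$ is a finite collection (family) $\mathscr{C}$ of subsets of $V$ such that, for any two distinct vertices $u,v\in V$, $uv\in E$ if and only if $u$ and $v$ appear together in an odd number of sets in $\mathscr{C}$. The subgraph complementation number $c_2(G)$ is the minimum cardinality of a subgraph complementation system for $G$. A linear forest is a graph every connected component of which is a path (a single vertex counts as a path). *)

(* Defs.v *)
From mathcomp Require Import all_boot.

Set Implicit Arguments.
Unset Strict Implicit.
Unset Printing Implicit Defensive.

Record sgraph := SGraph {
  vertex :> finType;
  adj : rel vertex;
  adj_sym : symmetric adj;
  adj_irrefl : irreflexive adj
}.

Definition edges (G : sgraph) : {set {set G}} :=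
  [set [set p.1; p.2] | p : G * G & adj p.1 p.2].

Definition component (G : sgraph) (x : G) : {set G} :=
  [set y | connect (@adj G) x y].

(* The subgraph of G induced by A is a path: s lists the vertices of A along
   the path, and two of them are adjacent exactly when they are consecutive
   in s. *)
Definition induces_path (G : sgraph) (A : {set G}) : Prop :=
  exists s : seq G,
    [/\ s != [::], uniq s, s =i A
      & {in A &, forall x y : G,
          adj x y = (index y s == (index x s).+1)
                    || (index x s == (index y s).+1)}].

Definition linear_forest (G : sgraph) : Prop :=
  forall x : G, induces_path (component x).

(* A family of vertex sets is a sequence, so repetitions are allowed and are
   counted by its size. *)
Definition subgraph_complementation_system
    (G : sgraph) (C : seq {set G}) : bool :=
  [forall u : G, forall v : G,
    (u != v) ==>
      (adj u v == odd (count (fun A : {set G} => (u \in A) && (v \in A)) C))].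

Definition has_system_of_size (G : sgraph) (k : nat) : bool :=
  [exists C : k.-tuple {set G}, subgraph_complementation_system C].

Lemma in_edges (G : sgraph) (u v : G) : ([set u; v] \in edges G) = adj u v.
Proof.
apply/imsetP/idP => [[[x y]]|uv]; last by exists (u, v); rewrite ?inE.
rewrite inE /= => xy E.
have /set2P uE : u \in [set x; y] by rewrite -E set21.
have /set2P vE : v \in [set x; y] by rewrite -E set22.
have /set2P xE : x \in [set u; v] by rewrite E set21.
have /set2P yE : y \in [set u; v] by rewrite E set22.
case: uE vE xE yE => -> [] -> xE yE; rewrite ?[adj y x]adj_sym //.
- by case: yE => yx; rewrite yx in xy.
- by case: xE => yx; rewrite yx in xy.
Qed.

Lemma edges_system (G : sgraph) :
  subgraph_complementation_system (enum (edges G)).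
Proof.
apply/forallP => u; apply/forallP => v; apply/implyP => uNv.
rewrite -in_edges (@eq_in_count _ _ (pred1 [set u; v])); last first.
  move=> A; rewrite mem_enum => /imsetP[[x y]]; rewrite inE /= => xy ->.
  apply/idP/eqP => [|->]; last by rewrite !inE !eqxx orbT.
  case/andP=> /set2P[] uE /set2P[] vE; rewrite uE vE ?eqxx // in uNv *.
  by rewrite setUC.
by rewrite count_uniq_mem ?enum_uniq // mem_enum oddb.
Qed.

Lemma exists_system (G : sgraph) : exists k, has_system_of_size G k.
Proof.
exists (size (enum (edges G))); apply/existsP.
by exists (in_tuple (enum (edges G))); exact: edges_system.
Qed.

Definition c2 (G : sgraph) : nat := ex_minn (exists_system G).

(* Main.v *)
(** A vertex with three neighbours [a], [b], [c] allows the three edges [xa],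
    [xb], [xc] to be replaced by the two sets [{x, a, b, c}] and [{a, b, c}].
    A cycle [x, v_1, ..., v_k], [2 <= k], is the sum modulo 2 of the [k - 1]
    triangles [{x, v_i, v_(i+1)}], which replace its [k + 1] edges.  A graph
    with maximum degree at most 2 and no cycle is a linear forest, since a
    longest path through a vertex exhausts its component. *)
Require Import Defs.
From mathcomp Require Import all_boot.

Set Implicit Arguments.
Unset Strict Implicit.
Unset Printing Implicit Defensive.

(** * Families of sets modulo 2, and claws *)

Section Systems.
Variable G : sgraph.
Implicit Types (u v x y : G) (s : seq G) (C D E : seq {set G}).

Definition parity C u v : bool :=
  odd (count (fun A : {set G} => (u \in A) && (v \in A)) C).

Lemma parity_cons A C u v :
  parity (A :: C) u v = ((u \in A) && (v \in A)) (+) parity C u v.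
Proof. by rewrite /parity /= oddD oddb. Qed.

Lemma parity_cat C D u v : parity (C ++ D) u v = parity C u v (+) parity D u v.
Proof. by rewrite /parity count_cat oddD. Qed.

Lemma parity_perm C D u v : perm_eq C D -> parity C u v = parity D u v.
Proof. by move=> /permP CD; rewrite /parity CD. Qed.

Lemma c2_le_size C : subgraph_complementation_system C -> c2 G <= size C.
Proof.
move=> sysC; rewrite /c2; case: ex_minnP => k _; apply.
by apply/existsP; exists (in_tuple C).
Qed.

(** The edges themselves, as two-element sets, form a system. Trading the edges of [E] for the fewer
    sets of [D] changes no parity at a pair of distinct vertices, so the result is a smaller
    system. *)
Lemma c2_exchange D E :
    uniq E -> {subset E <= edges G} -> size D < size E ->
    (forall u v, u != v -> parity D u v = parity E u v) ->
  c2 G <= #|edges G| - 1.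
Proof.
move=> uE sE ltDE parDE; set R := [seq e <- enum (edges G) | e \notin E].
have eqE : perm_eq [seq e <- enum (edges G) | e \in E] E.
  apply: uniq_perm => [|//|e]; first by rewrite filter_uniq ?enum_uniq.
  by rewrite mem_filter mem_enum; case: (boolP (e \in E)) => //= /sE.
have eqER : perm_eq (E ++ R) (enum (edges G)).
  apply: perm_trans (permEl (perm_filterC (mem E) _)).
  by rewrite perm_sym perm_cat2r.
have -> : #|edges G| - 1 = size E + size R - 1.
  by rewrite cardE -(perm_size eqER) size_cat.
(* As [size D < size E], the list [E] is nonempty and the subtraction of 1 is not truncated. *)
apply: (@leq_trans (size (D ++ R))); last first.
  rewrite size_cat leq_subRL ?addnA ?leq_add2r //.
  by rewrite addn_gt0 (leq_trans _ ltDE).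
apply: c2_le_size; apply/forallP => u; apply/forallP => v; apply/implyP => uv.
have /forallP/(_ u)/forallP/(_ v)/implyP/(_ uv)/eqP -> := edges_system G.
by rewrite -/(parity _ u v) -/(parity (D ++ R) u v) -(parity_perm u v eqER)
  !parity_cat parDE.
Qed.

Lemma set2_injr x y z : x != y -> [set x; y] = [set x; z] -> y = z.
Proof.
by move=> xy /setP/(_ y); rewrite !inE eqxx orbT eq_sym (negPf xy) => /esym/eqP.
Qed.

(** This lemma and the next put distinctness in a boolean form that rules out impossible rows when
    an identity of parities is checked by truth table. *)
Lemma eq_excl x y z : y != z -> ~~ ((x == y) && (x == z)).
Proof. by apply: contra => /andP[/eqP <- /eqP <-]. Qed.

Lemma neq_excl x y z : y != z -> ~~ ((y == x) && (z == x)).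
Proof. by apply: contra => /andP[/eqP -> /eqP ->]. Qed.

Lemma c2_claw x a b c :
    adj x a -> adj x b -> adj x c -> uniq [:: a; b; c] ->
  c2 G <= #|edges G| - 1.
Proof.
move=> xa xb xc; rewrite /= !inE negb_or andbT => /andP[/andP[ab ac] bc].
have neq z : adj x z -> x != z.
  by apply: contraTneq => <-; rewrite adj_irrefl.
(* A pair inside [{a, b, c}] lies in both new sets and cancels; a pair of [x] with one of the three
   lies in the first set only. *)
apply: (@c2_exchange [:: [set x; a; b; c]; [set a; b; c]]
                     [:: [set x; a]; [set x; b]; [set x; c]]) => //.
- rewrite /= !inE negb_or andbT -andbA; apply/and3P; split.
  + by apply: contra_neq ab; apply: set2_injr; exact: neq.
  + by apply: contra_neq ac; apply: set2_injr; exact: neq.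
  + by apply: contra_neq bc; apply: set2_injr; exact: neq.
- by move=> e; rewrite !inE => /or3P[] /eqP ->; rewrite in_edges.
move=> u v uv; rewrite !parity_cons !inE.
(* The table runs over the eight tests of [u] and [v] against [x], [a], [b], [c]. *)
move: (eq_excl u (neq _ xa)) (eq_excl u (neq _ xb)) (eq_excl u (neq _ xc)).
move: (eq_excl v (neq _ xa)) (eq_excl v (neq _ xb)) (eq_excl v (neq _ xc)).
move: (eq_excl u ab) (eq_excl u ac) (eq_excl u bc).
move: (eq_excl v ab) (eq_excl v ac) (eq_excl v bc).
move: (neq_excl x uv) (neq_excl a uv) (neq_excl b uv) (neq_excl c uv).
by do 8![case: (_ == _) => //=].
Qed.

(** * Cycles, triangulated from one vertex *)

Definition path_edges x s : seq {set G} := pairmap (fun a b => [set a; b]) x s.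

Definition fan x y s : seq {set G} := pairmap (fun a b => [set x; a; b]) y s.

Lemma parity_triangle x y z u v : uniq [:: x; y; z] -> u != v ->
  parity [:: [set x; y; z]] u v
    = parity [:: [set x; y]; [set y; z]; [set z; x]] u v.
Proof.
rewrite /= !inE negb_or andbT => /andP[/andP[xy xz] yz].
move=> uv; rewrite !parity_cons !inE.
move: (eq_excl u xy) (eq_excl u xz) (eq_excl u yz).
move: (eq_excl v xy) (eq_excl v xz) (eq_excl v yz).
move: (neq_excl x uv) (neq_excl y uv) (neq_excl z uv).
by do 6![case: (_ == _) => //=].
Qed.

(** Induction along the path: the first triangle shares the edge [{x, z}] with the boundary of the
    remaining fan, and this edge cancels modulo 2. For an empty path the two edges at [x] coincide
    and cancel. *)
Lemma parity_fan x y s u v : uniq [:: x, y & s] -> u != v ->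
  parity (fan x y s) u v
    = parity [:: [set x; y], [set last y s; x] & path_edges y s] u v.
Proof.
move=> + uv; elim: s y => [|z s IHs] y uxys.
  by rewrite /= !parity_cons setUC addbA addbb.
have [uxyz uxzs] : uniq [:: x; y; z] /\ uniq [:: x, z & s].
  move: uxys; rewrite /= !inE !negb_or -!andbA.
  by case/and5P=> -> -> -> -> /and3P[_ -> ->].
have := parity_triangle uxyz uv; have := IHs z uxzs.
rewrite /= !parity_cons [[set z; x]]setUC -[parity [::] u v]/false !addbF.
move=> -> ->.
by do 4![case: (_ && _)]; case: (parity _ _ _).
Qed.

Lemma path_edges_mem x s e z : e \in path_edges x s -> z \in e -> z \in x :: s.
Proof.
elim: s x => //= y s IHs x; rewrite inE => /predU1P[->|/IHs es /es zs].
  by rewrite !inE => /orP[] ->; rewrite ?orbT.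
by rewrite inE zs orbT.
Qed.

Lemma path_edges_uniq x s : uniq (x :: s) -> uniq (path_edges x s).
Proof.
elim: s x => //= y s IHs x /andP[xNys uys]; rewrite IHs // andbT.
by apply: contra xNys => /path_edges_mem; apply; rewrite set21.
Qed.

Lemma path_edges_sub x s :
  path (@adj G) x s -> {subset path_edges x s <= edges G}.
Proof.
elim: s x => //= y s IHs x /andP[xy ys] e.
by rewrite inE => /predU1P[->|/IHs]; [rewrite in_edges | apply].
Qed.

Lemma c2_cycle x y s :
    s != [::] -> uniq [:: x, y & s] -> cycle (@adj G) [:: x, y & s] ->
  c2 G <= #|edges G| - 1.
Proof.
move=> s0 u_xys; rewrite /= rcons_path => /and3P[xy ys lx].
apply: (@c2_exchange (fan x y s)
          [:: [set x; y], [set last y s; x] & path_edges y s]).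
- have /andP[xNys uys] := u_xys.
  (* Here [s] must be nonempty: the cycle then has at least three vertices, so its two edges at [x]
     differ. *)
  have lNy : y != last y s.
    case: s s0 uys {u_xys xNys ys lx} => //= z s _ /andP[yNzs _].
    by apply: contraNneq yNzs => ->; exact: mem_last.
  rewrite /= path_edges_uniq // andbT inE negb_or -andbA; apply/and3P; split.
  + rewrite [[set last y s; x]]setUC; apply: contra_neq lNy; apply: set2_injr.
    by apply: contraTneq xy => <-; rewrite adj_irrefl.
  + by apply: contra xNys => /path_edges_mem; apply; rewrite set21.
  + by apply: contra xNys => /path_edges_mem; apply; rewrite set22.
- move=> e; rewrite !inE => /or3P[/eqP->|/eqP->|]; rewrite ?in_edges //.
  exact: path_edges_sub.
- by rewrite /= /fan /path_edges !size_pairmap.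
- by move=> u v; exact: parity_fan.
Qed.

End Systems.

(** * Graphs with neither a cycle nor a vertex of degree 3 *)

Section LinearForests.
Variable G : sgraph.
Implicit Types (x y : G) (s : seq G).

Hypothesis acyclic : forall x y s,
  s != [::] -> uniq [:: x, y & s] -> ~~ cycle (@adj G) [:: x, y & s].
Hypothesis degree_le2 : forall x a b c,
  adj x a -> adj x b -> adj x c -> ~~ uniq [:: a; b; c].

(** An edge between non-consecutive vertices of a path would close a cycle with the stretch between
    them. The induction strips vertices until [x] heads the path. *)
Lemma acyclic_chordless s x y :
    uniq s -> sorted (@adj G) s -> x \in s -> y \in s -> adj x y ->
  index x s < index y s -> index y s = (index x s).+1.
Proof.
elim: s => //= a s IHs /andP[aNs us] ps; rewrite !inE.
case: (eqVneq x a) => [->|xa] /=; case: (eqVneq y a) => [->|ya] //=.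
- move=> _ ys ay _; congr _.+1.
  (* Either [y] directly follows [a], or some [z] does and [a, z, p, y] is a cycle. *)
  case/splitPr: ys => [[|z p] q] in us ps aNs *; first by rewrite /= eqxx.
  have /negP[] : ~~ cycle (@adj G) [:: a, z & rcons p y].
    apply: acyclic; first by rewrite -size_eq0 size_rcons.
    move: us aNs; rewrite -cat_rcons cat_uniq => /andP[+ _].
    rewrite mem_cat negb_or rcons_cons => u_zpy /andP[aN _].
    by rewrite cons_uniq aN.
  move: ps; rewrite -cat_rcons cat_path => /andP[ps _].
  rewrite [cycle _ _]/= rcons_path last_rcons [adj y a]adj_sym ay andbT.
  by move: ps; rewrite rcons_cons.
- rewrite ltnS => xs ys xy lt_xy.
  by rewrite IHs //; exact: path_sorted ps.
Qed.

(** Suppose a vertex [y] of the path has a neighbour [z] outside it. If [y] is an end, the path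
    extends by [z] and still contains [x], against maximality; otherwise [y] has three distinct
    neighbours. *)
Lemma longest_path_closed x s :
    uniq s -> sorted (@adj G) s -> x \in s ->
    (forall s', uniq s' -> sorted (@adj G) s' -> x \in s' ->
       size s' <= size s) ->
  closed (@adj G) s.
Proof.
move=> us ps xs max_s; apply: intro_closed => [|y z yz ys].
  by apply: sym_connect_sym; exact: adj_sym.
apply: contraT => zNs.
case/splitPr: ys => p q in us ps xs max_s zNs *.
(* The cases are [y] first, [y] last, and [y] between path neighbours [a] and [b]. *)
case: (lastP p) => [|p' a] in us ps xs max_s zNs *.
  have := max_s [:: z, y & q]; rewrite cons_uniq zNs us => /(_ isT).
  by rewrite /= [adj z y]adj_sym yz inE xs orbT ltnn => /(_ ps isT).
case: q => [|b q] in us ps xs max_s zNs *.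
  have := max_s (rcons (rcons p' a ++ [:: y]) z).
  rewrite rcons_uniq zNs us size_rcons ltnn mem_rcons inE xs orbT.
  suff -> : sorted (@adj G) (rcons (rcons p' a ++ [:: y]) z).
    by move/(_ isT isT isT).
  case: p' {us xs max_s zNs} ps => [|c p'] /=.
    by rewrite yz.
  by rewrite rcons_path last_cat /= yz andbT.
rewrite cat_rcons in us ps zNs.
have [ay yb] : adj a y /\ adj y b.
  by move: ps; rewrite sorted_cat_cons /= => /and4P[].
have /negP[] : ~~ uniq [:: a; b; z].
  by apply: (degree_le2 (x := y)) => //; rewrite adj_sym.
move: us zNs; rewrite cat_uniq /= mem_cat !inE !negb_or.
case/and3P=> _ _ /and3P[/and3P[_ ab _] _ _].
case/and5P=> _ za _ zb _.
by rewrite ab eq_sym za eq_sym zb.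
Qed.

Lemma acyclic_degree_le2_linear_forest : linear_forest G.
Proof.
move=> x.
(* Tuples make the existence of a path of given size through [x] a boolean, so that a maximal size,
   bounded by [#|G|], can be extracted. *)
pose P n := [exists t : n.-tuple G,
  [&& uniq t, sorted (@adj G) t & x \in (t : seq G)]].
have exP : exists n, P n.
  by exists 1; apply/existsP; exists [tuple x]; rewrite /= mem_head.
have ubP n : P n -> n <= #|G|.
  case/existsP=> t /andP[ut _].
  by rewrite -(size_tuple t) -(card_uniqP ut) max_card.
case: (ex_maxnP exP ubP) => n /existsP[t /and3P[ut pt xt]] max_n.
have closed_t : closed (@adj G) t.
  apply: (@longest_path_closed x) => // s us ps xs; rewrite size_tuple.
  by apply: max_n; apply/existsP; exists (in_tuple s); rewrite /= us ps.
exists t; split=> //.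
- by apply: contraTneq xt => ->.
- move=> y; rewrite inE; apply/idP/idP => [yt|/(closed_connect closed_t) <- //].
  case: (tval t) => // a s in pt xt yt *.
  have conn_sym : connect_sym (@adj G).
    by apply: sym_connect_sym; exact: adj_sym.
  by apply: (connect_trans (y := a)); [rewrite conn_sym|];
    exact: (path_connect pt).
- move=> y z; rewrite !inE => /(closed_connect closed_t).
  rewrite xt => /esym yt /(closed_connect closed_t); rewrite xt => /esym zt.
  apply/idP/idP => [yz|].
    case: (ltngtP (index y t) (index z t)) => [lt|lt|eq].
    + by rewrite (acyclic_chordless ut pt yt zt yz lt) eqxx.
    + rewrite adj_sym in yz.
      by rewrite (acyclic_chordless ut pt zt yt yz lt) eqxx orbT.
    + by rewrite (index_inj x yt zt eq) adj_irrefl in yz.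
  have consec a b : a \in (t : seq G) -> b \in (t : seq G) ->
      index b t = (index a t).+1 -> adj a b.
    move=> a_t b_t ab; rewrite -(nth_index a a_t) -(nth_index a b_t) ab.
    by move/(sortedP a): pt; apply; rewrite -ab index_mem.
  by case/orP=> /eqP; [|rewrite adj_sym]; exact: consec.
Qed.

End LinearForests.

Theorem theorem3p3 (G : sgraph) (not_linear : ~ linear_forest G) :
  c2 G <= #|edges G| - 1.
Proof.
(* If the bound fails, neither a cycle nor a claw can exist, since each would yield it. *)
apply: contraT => c2gt; case: not_linear.
apply: acyclic_degree_le2_linear_forest => [x y s s0 u|x a b c xa xb xc].
  by apply: contra c2gt; exact: c2_cycle.
by apply: contra c2gt; exact: c2_claw xa xb xc.
Qed.
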